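(* Let $G$ be a graph. Then, as formal power series in $q$ with integer coefficients, \[ \sum_{k,l\geq 0}(-1)^k\cdot \operatorname{rank}\bigl(\mathrm{MH}_{k,l}(G)\bigr)\cdot q^l=\#G . \]
   Context: A graph is a finite undirected graph with no loops or multiple edges; $V(G)$ and $E(G)$ are its vertex and edge sets. $d(x,y)=d_G(x,y)$ is the length of a shortest edge path from $x$ to $y$, with $d(x,y)=\infty$ if $x,y$ lie in different components. Magnitude: for a graph $G$ and $t>0$, equip $V(G)$ with the metric $t\cdot d_G$; the magnitude of a finite metric space is the sum of all entries of the inverse of the matrix $(e^{-d(x,y)})_{x,y}$ (when invertible). Writing $q=e^{-t}$, this is a rational function in $q$ whose power series expansion at $q=0$ has integer coefficients, and $\#G\in\mathbb{Z}[[q]]$ denotes this power series. Equivalently, $\#G$ is the sum of all entries of the inverse over $\mathbb{Z}[[q]]$ of the matrix $(q^{d_G(x,y)})_{x,y\in V(G)}$, with $q^\infty=0$. Magnitude homology: the length of a tuple of vertices is $\ell(x_0,\dots,x_k)=d(x_0,x_1)+\cdots+d(x_{k-1},x_k)$. For $k,l\ge 0$, $\mathrm{MC}_{k,l}(G)$ is the free abelian group on tuples $(x_0,\dots,x_k)$ of vertices with $x_{i-1}\ne x_{i}$ for $1\le i\le k$ (consecutive entries distinct) and $\ell(x_0,\dots,x_k)=l$. The differential $\partial\colon \mathrm{MC}_{k,l}(G)\to \mathrm{MC}_{k-1,l}(G)$ is $\partial=\sum_{i=1}^{k-1}(-1)^i\partial_i$, where $\partial_i(x_0,\dots,x_k)=(x_0,\dots,\widehat{x_i},\dots,x_k)$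 (omit $x_i$) if this tuple still has length $l$, and $\partial_i(x_0,\dots,x_k)=0$ otherwise. Then $\mathrm{MH}_{k,l}(G)=H_k(\mathrm{MC}_{*,l}(G))$. *)

(* Defs.v *)
From HB Require Import structures.
From mathcomp Require Import all_boot all_order all_algebra.
From mathcomp Require Import boolp classical_sets cardinality fsbigop.

Set Implicit Arguments.
Unset Strict Implicit.
Unset Printing Implicit Defensive.

Import Order.TTheory GRing.Theory Num.Theory.
Local Open Scope ring_scope.

(* The ring Z[[q]]: [coefz f n] is the coefficient of q^n in [f]. *)
Record zps := Zps { coefz : nat -> int }.

HB.instance Definition _ := gen_eqMixin zps.
HB.instance Definition _ := gen_choiceMixin zps.

Lemma zpsP (f g : zps) : coefz f =1 coefz g -> f = g.
Proof. by case: f g => [f] [g] /= /funext ->. Qed.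

Definition zps0 := Zps (fun _ => 0).
Definition zps1 := Zps (fun n => (n == 0%N)%:R).
Definition zps_opp f := Zps (fun n => - coefz f n).
Definition zps_add f g := Zps (fun n => coefz f n + coefz g n).
Definition zps_mul f g :=
  Zps (fun n => \sum_(i < n.+1) coefz f i * coefz g (n - i)).

Fact zps_addA : associative zps_add.
Proof. by move=> f g h; apply: zpsP => n /=; rewrite addrA. Qed.
Fact zps_addC : commutative zps_add.
Proof. by move=> f g; apply: zpsP => n /=; rewrite addrC. Qed.
Fact zps_add0 : left_id zps0 zps_add.
Proof. by move=> f; apply: zpsP => n /=; rewrite add0r. Qed.
Fact zps_addN : left_inverse zps0 zps_opp zps_add.
Proof. by move=> f; apply: zpsP => n /=; rewrite addNr. Qed.

HB.instance Definition _ :=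
  GRing.isZmodule.Build zps zps_addA zps_addC zps_add0 zps_addN.

Definition zps_trunc (n : nat) (f : zps) : {poly int} :=
  \poly_(i < n.+1) coefz f i.

Lemma coef_zps_trunc n f i : (i <= n)%N -> (zps_trunc n f)`_i = coefz f i.
Proof. by move=> le_in; rewrite coef_poly ltnS le_in. Qed.

Lemma coef_zps_truncM n f g i :
  (i <= n)%N -> (zps_trunc n f * zps_trunc n g)`_i = coefz (zps_mul f g) i.
Proof.
move=> le_in; rewrite coefM; apply: eq_bigr => j _.
have le_ji : (j <= i)%N by rewrite -ltnS.
by rewrite !coef_zps_trunc // ?(leq_trans le_ji) // (leq_trans (leq_subr _ _)).
Qed.

Fact zps_mulA : associative zps_mul.
Proof.
move=> f g h; apply: zpsP => n /=.
transitivity ((zps_trunc n f * (zps_trunc n g * zps_trunc n h))`_n).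
  rewrite coefM; apply: eq_bigr => i _.
  by rewrite coef_zps_truncM ?leq_subr // coef_zps_trunc // -ltnS.
rewrite mulrA coefM; apply: eq_bigr => i _.
by rewrite coef_zps_truncM ?coef_zps_trunc ?leq_subr // -ltnS.
Qed.
Fact zps_mulC : commutative zps_mul.
Proof.
by move=> f g; apply: zpsP => n; rewrite -!(@coef_zps_truncM n) // mulrC.
Qed.
Fact zps_mul1 : left_id zps1 zps_mul.
Proof.
move=> f; apply: zpsP => n /=.
rewrite big_ord_recl /= mul1r subn0 big1 ?addr0 //.
by move=> i _; rewrite mul0r.
Qed.
Fact zps_mulD : left_distributive zps_mul zps_add.
Proof.
move=> f g h; apply: zpsP => n /=; rewrite -big_split /=.
by apply: eq_bigr => i _; rewrite mulrDl.
Qed.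
Fact zps_1neq0 : zps1 != 0.
Proof. by apply/eqP => /(congr1 (coefz ^~ 0%N)). Qed.

HB.instance Definition _ := GRing.Zmodule_isComNzRing.Build zps
  zps_mulA zps_mulC zps_mul1 zps_mulD zps_1neq0.

Definition zps_unit : pred zps := fun f => `[< exists g, g * f = 1 >].
Definition zps_inv (f : zps) : zps :=
  if pselect (exists g, g * f = 1) is left ex_g then projT1 (cid ex_g) else f.

Fact zps_mulV : {in zps_unit, left_inverse 1 zps_inv *%R}.
Proof.
by move=> f /asboolP ex_g; rewrite /zps_inv; case: pselect => // ?; case: cid.
Qed.
Fact zps_unitP (f g : zps) : g * f = 1 -> zps_unit f.
Proof. by move=> gf1; apply/asboolP; exists g. Qed.
Fact zps_inv_out : {in [predC zps_unit], zps_inv =1 id}.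
Proof. by move=> f /asboolPn nex_g; rewrite /zps_inv; case: pselect. Qed.

HB.instance Definition _ :=
  GRing.ComNzRing_hasMulInverse.Build zps zps_mulV zps_unitP zps_inv_out.

Definition zpsX : zps := Zps (fun n => (n == 1%N)%:R).

Definition coefz0 (f : zps) : int := coefz f 0.
Fact coefz0_zmod : zmod_morphism coefz0.
Proof. by []. Qed.
HB.instance Definition _ :=
  GRing.isZmodMorphism.Build zps int coefz0 coefz0_zmod.
Fact coefz0_mon : monoid_morphism coefz0.
Proof. by split=> // f g; rewrite /coefz0 /= big_ord1. Qed.
HB.instance Definition _ :=
  GRing.isMonoidMorphism.Build zps int coefz0 coefz0_mon.

Lemma coefzD f g n : coefz (f + g) n = coefz f n + coefz g n. Proof. by []. Qed.
Lemma coefzB f g n : coefz (f - g) n = coefz f n - coefz g n. Proof. by []. Qed.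
Lemma coefzM f g n :
  coefz (f * g) n = \sum_(i < n.+1) coefz f i * coefz g (n - i).
Proof. by []. Qed.
Lemma coefz_sum (I : Type) (r : seq I) (P : pred I) (F : I -> zps) n :
  coefz (\sum_(i <- r | P i) F i) n = \sum_(i <- r | P i) coefz (F i) n.
Proof. exact: (big_morph (coefz ^~ n)). Qed.

Lemma coefzX_small (h : zps) m n :
  coefz h 0 = 0 -> (n < m)%N -> coefz (h ^+ m) n = 0.
Proof.
move=> h0; elim: m n => // m IH n; rewrite ltnS => le_nm.
rewrite exprS coefzM big_ord_recl h0 mul0r add0r big1 // => i _.
rewrite IH ?mulr0 //= /bump /= add1n subnS prednK ?subn_gt0 //.
by rewrite (leq_trans (leq_subr _ _)).
Qed.

Lemma coefz0_unit (f : zps) : coefz f 0 = 1 -> f \is a GRing.unit.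
Proof.
move=> f0; pose h := 1 - f.
have h0 : coefz h 0 = 0 by rewrite coefzB f0.
pose G n := \sum_(k < n.+1) h ^+ k.
pose g := Zps (fun n => coefz (G n) n).
have gE n i : (i <= n)%N -> coefz g i = coefz (G n) i.
  move=> le_in; rewrite /g /G /= !coefz_sum.
  rewrite -!(big_mkord xpredT (fun k => coefz (h ^+ k) i)).
  rewrite [in RHS](@big_cat_nat _ _ _ i.+1) //=.
  rewrite -[LHS]addr0; congr (_ + _); apply/esym.
  rewrite big_nat_cond big1 //.
  by move=> k /andP[/andP[lt_ik _] _]; apply: coefzX_small.
apply/asboolP; exists g; apply: zpsP => n.
have -> : coefz (g * f) n = coefz (G n * f) n.
  by rewrite !coefzM; apply: eq_bigr => i _; rewrite (gE n) // -ltnS.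
have -> : G n * f = 1 - h ^+ n.+1.
  have -> : f = 1 - h by rewrite /h opprB addrC subrK.
  by rewrite mulrC -[in RHS](expr1n _ n.+1) subrXX; congr (_ * _);
     apply: eq_bigr => i _; rewrite expr1n mul1r.
by rewrite coefzB coefzX_small // subr0.
Qed.

(* [f] sums to [s] in the q-adic topology of Z[[q]]: each power of q occurs in
   only finitely many of the series [f i], and the coefficients add up. *)
Definition zps_has_sum (I : choiceType) (f : I -> zps) (s : zps) : Prop :=
  forall n : nat,
    finite_set [set i | coefz (f i) n != 0] /\
    coefz s n = \sum_(i \in [set: I]) coefz (f i) n.

(* The homology, at B, of A --g--> B --f--> C: the quotient of ker f by the
   elements of ker f that are in the image of g. *)
Section Homology.
Variables (A B C : zmodType) (g : {additive A -> B}) (f : {additive B -> C}).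

Definition kernel_pred : {pred B} := [pred b | f b == 0].
Fact kernel_zmod : zmod_closed kernel_pred.
Proof.
split=> [|x y]; rewrite !inE ?raddf0 // raddfB => /eqP-> /eqP->.
by rewrite subrr.
Qed.
HB.instance Definition _ := GRing.isZmodClosed.Build B kernel_pred kernel_zmod.

Record kernel := Kernel { kernel_val : B; _ : kernel_val \in kernel_pred }.
HB.instance Definition _ := [isSub for kernel_val].
HB.instance Definition _ := [Choice of kernel by <:].
HB.instance Definition _ := [SubChoice_isSubZmodule of kernel by <:].

Definition image_pred : {pred kernel} :=
  [pred z | `[< exists a : A, val z = g a >]].
Fact image_zmod : zmod_closed image_pred.
Proof.
split=> [|x y]; first by apply/asboolP; exists 0; rewrite !raddf0.
move=> /asboolP[a xa] /asboolP[b yb]; apply/asboolP; exists (a - b).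
by rewrite (raddfB g) -xa -yb; apply: raddfB.
Qed.
HB.instance Definition _ :=
  GRing.isZmodClosed.Build kernel image_pred image_zmod.

Definition homology : zmodType := {ideal_quot image_pred}.
End Homology.

(* The rank of an abelian group is the maximal size of a Z-linearly independent
   family; [zrank] is 0 if there is no maximum, but for [MH k l] there is one
   by [zrank_MH]. *)
Definition zfree (A : zmodType) (n : nat) (v : 'I_n -> A) : Prop :=
  forall c : 'I_n -> int, \sum_i v i *~ c i = 0 -> forall i, c i = 0.

Definition zrank_spec (A : zmodType) (r : nat) : Prop :=
  (exists v : 'I_r -> A, zfree v) /\
  (forall n (v : 'I_n -> A), zfree v -> (n <= r)%N).

Definition zrank (A : zmodType) : nat := xget 0%N [set r | zrank_spec A r].

Lemma int_relation (J : finType) n (b : 'I_n -> {ffun J -> int}) :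
  (#|J| < n)%N ->
  exists2 c : 'I_n -> int, (exists i, c i != 0) & \sum_i b i *~ c i = 0.
Proof.
move=> lt_Jn.
pose M : 'M[rat]_(n, #|J|) := \matrix_(i, j) (b i (enum_val j))%:~R.
have /rowV0Pn[r /sub_kermxP rM r0] : kermx M != 0.
  rewrite -mxrank_eq0 mxrank_ker subn_eq0 -ltnNge.
  exact: leq_ltn_trans (rank_leq_col M) lt_Jn.
pose c i := numq (r 0 i) * \prod_(j | j != i) denq (r 0 j).
pose d : rat := \prod_j (denq (r 0 j))%:~R.
have cE i : (c i)%:~R = r 0 i * d.
  rewrite /d (bigD1 i) //= mulrA -numqE /c intrM; congr (_ * _).
  by rewrite rmorph_prod.
have d0 : d != 0 by apply/prodf_neq0 => j _; rewrite intr_eq0 denq_neq0.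
exists c.
  have /rV0Pn[i ri0] := r0; exists i.
  by rewrite -(intr_eq0 rat) cE mulf_neq0.
apply/ffunP => x; rewrite sum_ffunE [RHS]ffunE; apply: (@intr_inj rat).
rewrite rmorph_sum /=.
transitivity ((r *m M) 0 (enum_rank x) * d); last by rewrite rM mxE mul0r.
rewrite mxE mulr_suml; apply: eq_bigr => i _.
rewrite mxE enum_rankK mulrAC -cE.
have -> : (b i *~ c i) x = b i x *~ c i.
  pose ev (f : {ffun J -> int}) := f x.
  have evB : zmod_morphism ev by move=> f g; rewrite /ev !ffunE.
  pose evA := GRing.isZmodMorphism.Build _ _ ev evB.
  pose eva : {additive {ffun J -> int} -> int} := HB.pack ev evA.
  exact: (raddfMz eva).
by rewrite mulrzz intrM mulrC.
Qed.

Lemma zrank_homology (A C : zmodType) (J : finType)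
    (g : {additive A -> {ffun J -> int}})
    (f : {additive {ffun J -> int} -> C}) :
  zrank_spec (homology g f) (zrank (homology g f)).
Proof.
set H := homology g f.
pose P n := `[< exists v : 'I_n -> H, zfree v >].
have ex0 : exists n, P n.
  by exists 0%N; apply/asboolP; exists (fun=> 0) => c _ [].
have leJ n : P n -> (n <= #|J|)%N.
  move=> /asboolP[v free_v]; rewrite leqNgt; apply/negP => lt_Jn.
  pose z i : kernel f := repr (v i).
  have [c [i ci] c0] := int_relation (fun i => val (z i)) lt_Jn.
  case/eqP: ci; apply: free_v.
  have -> : \sum_i v i *~ c i =
      (\pi_({ideal_quot @image_pred _ _ _ g f}) (\sum_i z i *~ c i))%qT.
    by rewrite raddf_sum; apply: eq_bigr => j _; rewrite raddfMz /= reprK.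
  have -> : \sum_i z i *~ c i = 0.
    apply: val_inj; rewrite (raddf_sum val) raddf0 -[RHS]c0.
    by apply: eq_bigr => j _; rewrite (raddfMz val).
  exact: raddf0.
case: (ex_maxnP ex0 leJ) => r /asboolP Pr max_r.
rewrite /zrank; case: xgetP => [n -> //|/(_ r)[]]; split=> // n v free_v.
by apply: max_r; apply/asboolP; exists v.
Qed.

(* Elements of N + {oo}, with None standing for oo. *)
Definition oaddn (a b : option nat) : option nat :=
  if (a, b) is (Some m, Some n) then Some (m + n)%N else None.

(* A graph is a symmetric irreflexive relation [e] on a finite type [T] of
   vertices; symmetry and irreflexivity play no role in the definitions. *)
Section Magnitude.
Variables (T : finType) (e : rel T).

Definition has_walk (x y : T) (n : nat) : bool :=
  [exists p : n.-tuple T, path e x p && (last x p == y)].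

Definition gdist (x y : T) : option nat :=
  if pselect (exists n, has_walk x y n) is left ex_n then Some (ex_minn ex_n)
  else None.

Lemma gdist_eq0 x y : (gdist x y == Some 0%N) = (x == y).
Proof.
apply/eqP/eqP => [|->]; rewrite /gdist; case: pselect => [ex_n|nex] //.
- case: ex_minnP => n /existsP[p /andP[_ /eqP <-]] _ [n0].
  by move: p; rewrite n0 => p; rewrite tuple0.
- have w0 : has_walk y y 0 by apply/existsP; exists [tuple]; rewrite /= eqxx.
  by case: ex_minnP => n _ /(_ _ w0); rewrite leqn0 => /eqP ->.
- by case: nex; exists 0%N; apply/existsP; exists [tuple]; rewrite /= eqxx.
Qed.

Definition zpsXo (d : option nat) : zps := if d is Some n then zpsX ^+ n else 0.

Definition similarity : 'M[zps]_#|T| :=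
  \matrix_(i, j) zpsXo (gdist (enum_val i) (enum_val j)).

Lemma similarity_unit : similarity \in unitmx.
Proof.
apply: coefz0_unit; rewrite -/(coefz0 _) -det_map_mx.
suff -> : map_mx coefz0 similarity = 1%:M by rewrite det1.
apply/matrixP => i j; rewrite !mxE -(inj_eq enum_val_inj) -gdist_eq0.
case: gdist => [[|n]|] //=.
by rewrite /coefz0 exprS coefzM big_ord1 /= mul0r.
Qed.

(* By [similarity_unit], [invmx] is a genuine inverse here. *)
Definition magnitude : zps := \sum_i \sum_j invmx similarity i j.

Definition tuple_length (k : nat) (x : k.+1.-tuple T) : option nat :=
  \big[oaddn/Some 0%N]_(d <- pairmap gdist (thead x) (behead x)) d.

Definition is_gen (k l : nat) : pred (k.+1.-tuple T) :=
  fun x => sorted (fun a b => a != b) x && (tuple_length x == Some l).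
Arguments is_gen k l x : clear implicits.

Definition gen (k l : nat) : finType := {x : k.+1.-tuple T | is_gen k l x}.

(* The free abelian group on [gen k l]. *)
Definition MC (k l : nat) : zmodType := {ffun gen k l -> int}.

Definition MCbasis k l (y : gen k l) : MC k l := [ffun z => (z == y)%:R].

Definition tuple_omit k (i : 'I_k.+2) (x : k.+2.-tuple T) : k.+1.-tuple T :=
  [tuple tnth x (lift i j) | j < k.+1].

(* When the omitted tuple has length l, its consecutive entries are
   automatically distinct, so [insub] only tests the length. *)
Definition face k l (i : 'I_k.+2) (x : gen k.+1 l) : MC k l :=
  if insub (tuple_omit i (val x)) is Some y then MCbasis y else 0.

(* MC_{-1,l} = 0 is encoded by the zero map out of degree 0, whose codomain is
   then irrelevant. *)
Definition boundary (k l : nat) : MC k l -> MC k.-1 l :=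
  match k return MC k l -> MC k.-1 l with
  | 0 => fun=> 0
  | k'.+1 => fun c =>
      \sum_(x : gen k'.+1 l)
        (\sum_(i < k'.+2 | (0 < i < k'.+1)%N) face i x *~ (-1) ^+ i) *~ c x
  end.

Fact boundary_additive k l : zmod_morphism (@boundary k l).
Proof.
case: k => [|k] c c' /=; first by rewrite subrr.
by rewrite -sumrB; apply: eq_bigr => x _; rewrite !ffunE mulrzBr.
Qed.
HB.instance Definition _ k l :=
  GRing.isZmodMorphism.Build (MC k l) (MC k.-1 l) (@boundary k l)
    (@boundary_additive k l).

Definition MH (k l : nat) : zmodType :=
  @homology (MC k.+1 l) (MC k l) (MC k.-1 l) (@boundary k.+1 l) (@boundary k l).

Lemma zrank_MH k l : zrank_spec (MH k l) (zrank (MH k l)).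
Proof. exact: zrank_homology. Qed.

End Magnitude.

(* Main.v *)
From HB Require Import structures.
Require Import Defs.
From mathcomp Require Import all_boot all_order all_algebra.
From mathcomp Require Import boolp classical_sets cardinality fsbigop.

(** Fix n. Both sides have the same coefficient of q^n because both equal the
    alternating sum over k of the number of generators of MC_{k,n}, that is, of
    tuples (x_0, ..., x_k) of length n with distinct consecutive entries.

    For the magnitude ([coefz_magnitude]), the similarity matrix is 1 + N, where N
    vanishes on the diagonal and its other entries have no constant term. The
    inverse is therefore the geometric series of the powers of -N, and the entries
    of N^k are the sums of q^length over the k-step walks with distinct
    consecutive vertices. Each step has length at least 1, so only k <= n matter.

    For magnitude homology ([euler_characteristic]), this is the Euler-Poincare
    principle. The complex MC_{*,n} vanishes above degree n, and the rank of the
    homology in degree k is the rank of MC_{k,n} minus the ranks of the incoming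
    and outgoing boundary maps ([zrank_homologyE]), which cancel in the alternating
    sum. The rank formula holds over Q by rank-nullity, and passing from Z to Q is
    a matter of clearing denominators. It requires that the boundary of a boundary
    be zero ([boundary_boundary]). The usual simplicial cancellation applies, but
    the faces that shorten a tuple are set to 0, so one must know that whether a
    double face vanishes does not depend on the order of the two omissions; this
    follows from the triangle inequality ([is_gen_omit]). *)

Set Implicit Arguments.
Unset Strict Implicit.
Unset Printing Implicit Defensive.

Import Order.TTheory GRing.Theory Num.Theory.
Local Open Scope ring_scope.

(** * The rank of the homology of a complex of free abelian groups *)

Lemma clear_denominators (I : finType) (r : I -> rat) :
  exists2 d : int, d != 0 &
    exists c : I -> int, forall i, (c i)%:~R = d%:~R * r i.
Proof.
exists (\prod_i denq (r i)).
  by apply/prodf_neq0 => i _; rewrite denq_neq0.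
exists (fun i => numq (r i) * \prod_(j | j != i) denq (r j)) => i.
by rewrite [in RHS](bigD1 i) //= !intrM numqE -[LHS]mulrA [LHS]mulrC.
Qed.

Lemma ffunMzE (J : finType) (V : zmodType) (b : {ffun J -> V}) n x :
  (b *~ n) x = b x *~ n.
Proof.
have ffunMnE m : (b *+ m) x = b x *+ m.
  by elim: m => [|m IHm]; rewrite ?mulr0n ?ffunE // !mulrS ffunE IHm.
by case: n => n; rewrite ?NegzE ?mulrNz ?ffunE -!pmulrn ffunMnE.
Qed.

(** Ranks of free abelian groups are computed after tensoring with the rationals:
    [ratrow] is the embedding of Z^J into Q^J, with coordinates listed in the
    order of [enum J], and [ratmx f] is the matrix of f, acting on the right of
    row vectors. *)
Definition ratrow (J : finType) (b : {ffun J -> int}) : 'rV[rat]_#|J| :=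
  \row_j (b (enum_val j))%:~R.

Fact ratrow_zmod (J : finType) : zmod_morphism (@ratrow J).
Proof. by move=> b c; apply/rowP => j; rewrite !mxE !ffunE rmorphB. Qed.
HB.instance Definition _ (J : finType) :=
  GRing.isZmodMorphism.Build {ffun J -> int} 'rV[rat]_#|J|
    (@ratrow J) (@ratrow_zmod J).

Lemma ratrow_inj (J : finType) : injective (@ratrow J).
Proof.
move=> b c /rowP bc; apply/ffunP => x.
by have := bc (enum_rank x); rewrite !mxE enum_rankK => /intr_inj.
Qed.

Lemma ratrow_mulz (J : finType) (b : {ffun J -> int}) n :
  ratrow (b *~ n) = n%:~R *: ratrow b.
Proof. by rewrite raddfMz scaler_int. Qed.

(** Every rational vector has an integral multiple: Q^J is the localization of
    Z^J at the nonzero integers. *)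
Lemma ratrow_surj (J : finType) (r : 'rV[rat]_#|J|) :
  exists2 d : int, d != 0 & exists b, ratrow b = d%:~R *: r.
Proof.
have [d d0 [c cE]] := clear_denominators (r 0).
exists d => //; exists [ffun x => c (enum_rank x)].
by apply/rowP => j; rewrite !mxE ffunE enum_valK cE.
Qed.

Definition ratmx (J K : finType) (f : {ffun J -> int} -> {ffun K -> int}) :
    'M[rat]_(#|J|, #|K|) :=
  \matrix_i ratrow (f [ffun x => (x == enum_val i)%:R]).

Lemma ratrow_mulmx (J K : finType)
    (f : {additive {ffun J -> int} -> {ffun K -> int}}) b :
  ratrow (f b) = ratrow b *m ratmx f.
Proof.
have {1}-> : b =
    \sum_(i < #|J|) [ffun x => (x == enum_val i)%:R] *~ b (enum_val i).
  apply/ffunP => x; rewrite sum_ffunE (bigD1 (enum_rank x)) //= big1 ?addr0.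
    by rewrite ffunMzE ffunE enum_rankK eqxx intz.
  move=> i ix; rewrite ffunMzE ffunE -(can_eq enum_rankK) enum_valK eq_sym.
  by rewrite (negPf ix) mul0rz.
rewrite !raddf_sum mulmx_sum_row; apply: eq_bigr => i _.
by rewrite !raddfMz rowK mxE scaler_int.
Qed.

Lemma ratmx_sub_kermx (I J K : finType)
    (g : {additive {ffun I -> int} -> {ffun J -> int}})
    (f : {additive {ffun J -> int} -> {ffun K -> int}}) :
  (forall a, f (g a) = 0) -> (ratmx g <= kermx (ratmx f))%MS.
Proof.
move=> fg0; apply/sub_kermxP/row_matrixP => i.
by rewrite row_mul rowK row0 -ratrow_mulmx fg0 raddf0.
Qed.

Section HomologyRank.
Variables (I J K : finType).
Variables (g : {additive {ffun I -> int} -> {ffun J -> int}}).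
Variables (f : {additive {ffun J -> int} -> {ffun K -> int}}).

Let H := homology g f.
Let homology_class (z : kernel f) : H :=
  (\pi_({ideal_quot @image_pred _ _ _ g f}) z)%qT.

Lemma homology_class_eq0 z : homology_class z = 0 <-> exists a, val z = g a.
Proof.
have -> : (0 : H) = homology_class 0 by rewrite /homology_class raddf0.
split=> [/eqP|ex_a].
  by rewrite -Quotient.idealrBE subr0 => /asboolP.
by apply/eqP; rewrite -Quotient.idealrBE subr0; apply/asboolP.
Qed.

Lemma homology_class_sum n (z : 'I_n -> kernel f) (c : 'I_n -> int) :
  \sum_i homology_class (z i) *~ c i = homology_class (\sum_i z i *~ c i).
Proof.
by rewrite /homology_class raddf_sum; apply: eq_bigr => i _; rewrite raddfMz.
Qed.

Lemma ratrow_sum n (z : 'I_n -> kernel f) (c : 'I_n -> int) :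
  ratrow (val (\sum_i z i *~ c i)) =
  (\row_i (c i)%:~R) *m \matrix_i ratrow (val (z i)).
Proof.
rewrite (raddf_sum val) raddf_sum mulmx_sum_row; apply: eq_bigr => i _.
rewrite rowK mxE -ratrow_mulz; congr (ratrow _); exact: (raddfMz val).
Qed.

Lemma ratrow_kernelE b : (f b == 0) = (ratrow b <= kermx (ratmx f))%MS.
Proof.
rewrite sub_kermx -ratrow_mulmx.
by rewrite -(inj_eq (@ratrow_inj _)) raddf0.
Qed.

(** An integral family of cycles whose classes are independent stays independent
    over Q, even modulo the rational boundaries: in a rational relation the
    coefficients and the bounding chain can be made integral by multiplying by
    nonzero integers d and d'. The rational span V of the cycles therefore meets
    the boundaries trivially, and both subspaces lie in the rational cycles. *)
Lemma zfree_homology_leq n (v : 'I_n -> H) :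
  (forall a, f (g a) = 0) ->
  zfree v -> (n + \rank (ratmx g) <= \rank (kermx (ratmx f)))%N.
Proof.
move=> fg0 free_v; pose z i : kernel f := repr (v i).
have vE i : v i = homology_class (z i) by rewrite /homology_class reprK.
pose V : 'M[rat]_(n, #|J|) := \matrix_i ratrow (val (z i)).
have disj (u : 'rV_n) : (u *m V <= ratmx g)%MS -> u = 0.
  case/submxP => w uVE.
  have [d d0 [c cE]] := clear_denominators (u 0).
  have [d' d'0 [b bE]] := ratrow_surj w.
  suff cd0 : forall i, d' * c i = 0.
    apply/rowP => i; rewrite mxE; have /eqP := cd0 i.
    rewrite mulf_eq0 (negPf d'0) /= => /eqP ci0.
    have /esym/eqP := cE i; rewrite ci0 mulf_eq0 intr_eq0 (negPf d0).
    by move/eqP.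
  apply: free_v; under eq_bigr do rewrite vE.
  rewrite homology_class_sum; apply/homology_class_eq0; exists (b *~ d).
  apply: ratrow_inj; rewrite ratrow_sum -/V ratrow_mulmx ratrow_mulz bE.
  rewrite -!scalemxAl -uVE !scalemxAl; congr (_ *m _).
  by apply/rowP => i; rewrite !mxE intrM cE mulrCA.
have freeV : \rank V = n.
  apply/eqP/inj_row_free => u uV0; apply: disj.
  by rewrite uV0 sub0mx.
have capV : (V :&: ratmx g)%MS = 0.
  apply/eqP/rowV0P => w; rewrite sub_capmx => /andP[/submxP[u ->] /disj ->].
  by rewrite mul0mx.
rewrite -{1}freeV -(mxrank_disjoint_sum capV); apply: mxrankS.
rewrite addsmx_sub ratmx_sub_kermx // andbT; apply/row_subP => i.
by rewrite rowK -ratrow_kernelE; apply: (valP (z i)).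
Qed.

(** Conversely, a basis of a complement of the rational boundaries in the
    rational cycles becomes, after clearing a common denominator d, a family of
    integral cycles whose classes are independent. *)
Lemma zfree_homology_ex :
  exists v : 'I_(\rank (kermx (ratmx f) :\: ratmx g)) -> H, zfree v.
Proof.
set W := (_ :\: _)%MS; set r := \rank W.
have [d d0 [c cE]] := clear_denominators
  (fun ij : 'I_r * 'I_#|J| => row_base W ij.1 ij.2).
pose b i : {ffun J -> int} := [ffun x => c (i, enum_rank x)].
have bE i : ratrow (b i) = d%:~R *: row i (row_base W).
  apply/rowP => j; rewrite mxE ffunE enum_valK cE [RHS]mxE.
  by rewrite [X in _ = _ * X]mxE.
have WS u : (u *m row_base W <= W)%MS.
  by apply: submx_trans (submxMl _ _) _; rewrite eq_row_base submx_refl.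
have b_ker i : b i \in kernel_pred f.
  rewrite inE ratrow_kernelE bE scalemx_sub // rowE.
  by apply: submx_trans (WS _ _) _; rewrite diffmxSl.
exists (fun i => homology_class (Kernel (b_ker i))) => k.
rewrite homology_class_sum => /homology_class_eq0[a].
move=> /(congr1 (@ratrow _)); rewrite ratrow_sum ratrow_mulmx.
have -> : \matrix_i ratrow (val (Kernel (b_ker i))) = d%:~R *: row_base W.
  by apply/row_matrixP => i; rewrite rowK bE linearZ.
rewrite -scalemxAr => kE.
set u := \row_i _ in kE.
have : (u *m row_base W <= W :&: ratmx g)%MS.
  rewrite sub_capmx WS -[X in (X <= _)%MS]scale1r.
  rewrite -(@mulVf _ (d%:~R : rat)) ?intr_eq0 // -scalerA kE.
  by rewrite scalemx_sub ?submxMl.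
rewrite capmx_diff submx0 mulmx_free_eq0 ?row_base_free // => /eqP/rowP u0 i.
by have /eqP := u0 i; rewrite !mxE intr_eq0 => /eqP.
Qed.

(** Rank-nullity for a complex: the rank of the homology is the dimension of the
    rational cycles minus that of the rational boundaries. It is stated
    additively, which avoids truncated subtraction. *)
Lemma zrank_homologyE : (forall a, f (g a) = 0) ->
  (zrank H + \rank (ratmx f) + \rank (ratmx g) = #|J|)%N.
Proof.
move=> fg0; have [[v free_v] max_v] := zrank_homology g f.
have [w free_w] := zfree_homology_ex.
have le1 := zfree_homology_leq fg0 free_v.
have le2 := max_v _ _ free_w.
have := mxrank_cap_compl (kermx (ratmx f)) (ratmx g).
rewrite (capmx_idPr (ratmx_sub_kermx fg0)) => rkE.
have zE : (zrank H + \rank (ratmx g))%N = \rank (kermx (ratmx f)).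
  apply/eqP; rewrite eqn_leq le1 -rkE [X in (_ <= X)%N]addnC leq_add2l.
  exact: le2.
by rewrite addnAC zE mxrank_ker subnK ?rank_leq_row.
Qed.

End HomologyRank.

(** * Omitting entries of a list *)

(** List counterpart of [tuple_omit]. The recursion makes the identities below
    provable by simultaneous induction on the index and the list. *)
Fixpoint omit (U : Type) i (s : seq U) : seq U :=
  match i, s with
  | _, [::] => [::]
  | 0%N, _ :: s' => s'
  | i'.+1, a :: s' => a :: omit i' s'
  end.

Lemma nth_omit (U : Type) (u : U) i s j : nth u (omit i s) j = nth u s (bump i j).
Proof.
elim: i s j => [|i IHi] [|a s] [|j] //=; first by rewrite nth_nil.
by rewrite IHi bumpS.
Qed.

Lemma size_omit (U : Type) i (s : seq U) :
  (i < size s)%N -> size (omit i s) = (size s).-1.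
Proof.
elim: i s => [|i IHi] [|a s] //= lt_is.
by rewrite IHi // prednK // (leq_ltn_trans (leq0n i) lt_is).
Qed.

Lemma omit_omit (U : Type) i j (s : seq U) :
  (i <= j)%N -> omit i (omit j.+1 s) = omit j (omit i s).
Proof. by elim: i j s => [|i IHi] [|j] [|a s] //= le_ij; rewrite IHi. Qed.

Lemma tval_tuple_omit (T : finType) k (i : 'I_k.+2) (x : k.+2.-tuple T) :
  tuple_omit i x = omit i x :> seq T.
Proof.
have lt_ix : (i < size x)%N by rewrite size_tuple.
apply: (@eq_from_nth _ (thead x)) => [|j].
  by rewrite size_omit // !size_tuple.
rewrite size_tuple => lt_jk.
rewrite (nth_mktuple _ _ (Ordinal lt_jk)) nth_omit (tnth_nth (thead x)).
by [].
Qed.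

(** * The metric and the length of walks *)

(** The order of N + {oo}, with None standing for oo. *)
Definition ole (a b : option nat) : bool :=
  if b is Some n then if a is Some m then (m <= n)%N else false else true.

Lemma ole_oaddn a b c d : ole a b -> ole c d -> ole (oaddn a c) (oaddn b d).
Proof. by case: a b c d => [m|] [n|] [p|] [q|] //=; apply: leq_add. Qed.

Lemma oaddnA : associative oaddn.
Proof. by case=> [m|] [n|] [p|] //; rewrite /oaddn addnA. Qed.

Section MagnitudeComplex.
Variables (T : finType) (e : rel T).

Lemma gdist_le x y n : has_walk e x y n -> ole (gdist e x y) (Some n).
Proof.
rewrite /gdist => w; case: pselect => [ex_n|]; last by case; exists n.
by case: ex_minnP => m _; apply.
Qed.

Lemma gdist_walk x y n : gdist e x y = Some n -> has_walk e x y n.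
Proof.
rewrite /gdist; case: pselect => // ex_n [<-].
by case: ex_minnP.
Qed.

Lemma gdist_triangle b a c :
  ole (gdist e a c) (oaddn (gdist e a b) (gdist e b c)).
Proof.
case ab: (gdist e a b) => [m|] //; case bc: (gdist e b c) => [n|] //=.
have /existsP[p /andP[ep /eqP lp]] := gdist_walk ab.
have /existsP[r /andP[er /eqP lr]] := gdist_walk bc.
apply: gdist_le; apply/existsP; exists [tuple of p ++ r].
by rewrite /= cat_path last_cat ep lp er lr eqxx.
Qed.

Fixpoint walk_length (a : T) (s : seq T) : option nat :=
  if s is b :: s' then oaddn (gdist e a b) (walk_length b s') else Some 0%N.

Lemma tuple_lengthE k (x : k.+1.-tuple T) :
  tuple_length e x = walk_length (thead x) (behead x).
Proof.
rewrite /tuple_length; elim: (behead _) (thead _) => [|b s IHs] a /=.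
  by rewrite big_nil.
by rewrite big_cons IHs.
Qed.

(** By the triangle inequality, omitting a vertex other than the first one never
    increases the length. *)
Lemma walk_length_omit a i s :
  ole (walk_length a (omit i s)) (walk_length a s).
Proof.
elim: i a s => [|i IHi] a [|b [|c s]] //=.
- by case: gdist.
- by rewrite oaddnA ole_oaddn ?gdist_triangle //; case: walk_length => //=.
- by case: (i) => /=; case: gdist => //=.
- apply: ole_oaddn; first by case: gdist => /=.
  exact: (IHi b (c :: s)).
Qed.

(** If the neighbours a and c of an omitted vertex b coincided, then the detour
    through b, of positive length, would be lost, and the length would drop. *)
Lemma path_neq_omit a i s l :
  path (fun x y => x != y) a s ->
  walk_length a s = Some l -> walk_length a (omit i s) = Some l ->
  path (fun x y => x != y) a (omit i s).
Proof.
elim: i a s l => [|i IHi] a [|b [|c s]] l //=.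
- move=> /and3P[ab bc ->] lenE lenE'; rewrite andbT.
  apply: contraNneq ab => ac; rewrite -(gdist_eq0 e).
  move: lenE lenE'; rewrite -ac.
  have /eqP-> : gdist e a a == Some 0%N by rewrite gdist_eq0.
  case: gdist => [m|] //; case: gdist => [n|] //; case: walk_length => [p|] //=.
  move=> [<-] [] /eqP; rewrite add0n addnA -[X in X == _]add0n eqn_add2r.
  by rewrite eq_sym addn_eq0 => /andP[/eqP->].
- by case: (i).
- move=> /andP[-> bs]; rewrite andTb; case: (gdist e a b) => [m|] //.
  case bsE: (oaddn (gdist e b c) _) => [n|] //= [<-].
  case bsE': (walk_length _ _) => [n'|] //= [/eqP].
  rewrite eqn_add2l => /eqP n'n.
  by apply: (IHi b (c :: s) n) => //; rewrite -n'n.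
Qed.

(** * The boundary of a boundary is zero *)

#[local] Arguments omit : simpl never.

Lemma is_genE k l (x : k.+1.-tuple T) :
  is_gen e l x =
  path (fun x y => x != y) (thead x) (behead x) &&
  (walk_length (thead x) (behead x) == Some l).
Proof. by rewrite /is_gen tuple_lengthE [in sorted _ _](tuple_eta x). Qed.

(** If omitting two vertices keeps the length, then so does omitting only the one
    that goes first, since omissions never increase the length. Hence a composite
    of two faces is nonzero exactly when the tuple with both vertices omitted
    still has length l, a condition that does not depend on the order of omission.
    This makes the simplicial identities hold although some faces vanish. *)
Lemma is_gen_omit k l (x : k.+3.-tuple T) (z : k.+1.-tuple T)
    (y : k.+2.-tuple T) i j :
  is_gen e l x -> is_gen e l z ->
  y = omit j.+1 x :> seq T -> z = omit i.+1 y :> seq T -> is_gen e l y.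
Proof.
rewrite !is_genE; case/tupleP: x => a x; case/tupleP: y => b y.
case/tupleP: z => c z; rewrite !theadE /=.
move=> /andP[px /eqP lx] /andP[_ /eqP lz] [ba yx] [cb zy].
subst a b; have ly : walk_length c y = Some l.
  have := walk_length_omit c j x; rewrite -yx lx.
  have := walk_length_omit c i y; rewrite -zy lz.
  case: walk_length => [n|] //= ln nl; congr Some; apply/eqP.
  by rewrite eqn_leq nl ln.
by rewrite ly eqxx andbT yx (path_neq_omit px lx) // -yx.
Qed.

Lemma interior_sum (V : nmodType) k (F : nat -> V) :
  \sum_(i < k.+2 | (0 < i < k.+1)%N) F i = \sum_(i < k) F i.+1.
Proof.
rewrite big_mkcond big_ord_recl big_ord_recr /= ltnn addr0 add0r.
by apply: eq_bigr => i _; rewrite /bump /= add1n ltnS ltn_ord.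
Qed.

(** The cancellation behind the equation that the square of a simplicial
    boundary is zero. In passing from n to n + 1 the double sum gains the last
    column (i = n) and the last row (j = n + 1); the hypothesis identifies the
    entries of the row with those of the column, with opposite signs. *)
Lemma simplicial_cancellation n (G : nat -> nat -> int) :
  (forall i j, (i <= j)%N -> G j.+1 i = G i j) ->
  \sum_(j < n.+1) \sum_(i < n) (-1) ^+ (i + j) * G j i = 0.
Proof.
move=> GE; elim: n => [|n IHn]; first by rewrite big1 // => j _; rewrite big_ord0.
rewrite big_ord_recr /=; under eq_bigr do rewrite big_ord_recr /=.
rewrite big_split /= IHn add0r -big_split big1 //= => i _.
have le_in : (i <= n)%N by rewrite -ltnS.
by rewrite (GE _ _ le_in) addnS exprS mulN1r addnC mulNr subrr.
Qed.

(** Since z is a generator, the test that the omitted tuple is one is subsumed by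
    the comparison with z. *)
Lemma face_coordE k l (i : 'I_k.+2) (x : gen e k.+1 l) (z : gen e k l) :
  face i x z = ((val z : seq T) == omit i (val x))%:R.
Proof.
rewrite /face -tval_tuple_omit val_eqE.
case: insubP => [y _ <-|ngen]; first by rewrite ffunE val_eqE.
rewrite ffunE; case: eqP => // zE; case/negP: ngen; rewrite -zE.
exact: (valP z).
Qed.

Lemma boundaryE k l (c : MC e k.+1 l) (z : gen e k l) :
  boundary c z =
  \sum_x c x * \sum_(i < k) (-1) ^+ i.+1 *
     ((val z : seq T) == omit i.+1 (val x))%:R.
Proof.
rewrite /= sum_ffunE; apply: eq_bigr => x _.
rewrite ffunMzE sum_ffunE mulrzz mulrC; congr (_ * _).
rewrite -(interior_sum k
  (fun i => (-1) ^+ i * ((val z : seq T) == omit i (val x))%:R)).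
by apply: eq_bigr => i _; rewrite ffunMzE face_coordE mulrzz mulrC.
Qed.

(** In the coordinate z, the double boundary of a generator x is the alternating
    sum over pairs of interior omissions that turn x into z; the intermediate
    tuple y is a generator whenever the result is one ([is_gen_omit]), so the sum
    over y collapses and [simplicial_cancellation] applies. *)
Lemma boundary_boundary k l (c : MC e k.+1 l) : boundary (boundary c) = 0.
Proof.
case: k c => [//|k] c; apply/ffunP => z; rewrite [RHS]ffunE boundaryE.
under eq_bigr => y _.
  rewrite boundaryE mulr_suml.
  under eq_bigr => x _ do rewrite -mulrA.
  over.
rewrite exchange_big big1 //= => x _; rewrite -mulr_sumr.
apply/eqP; rewrite mulf_eq0; apply/orP; right; apply/eqP.
pose G j i : int := ((val z : seq T) == omit i.+1 (omit j.+1 (val x)))%:R.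
rewrite -[RHS](@simplicial_cancellation k G); last first.
  by move=> i j le_ij; rewrite /G omit_omit.
under eq_bigr do rewrite mulr_suml.
rewrite exchange_big; apply: eq_bigr => j _ /=.
under eq_bigr do rewrite mulr_sumr.
rewrite exchange_big; apply: eq_bigr => i _ /=.
have omitP : (j.+1 < k.+3)%N by rewrite !ltnS ltnW.
pose y := tuple_omit (Ordinal omitP) (val x).
have yE : y = omit j.+1 (val x) :> seq T by rewrite tval_tuple_omit.
case: (boolP (is_gen e l y)) => [gy|ngy].
  rewrite (bigD1 (Sub y gy)) //= -yE eqxx mulr1 big1 => [|y' y'y].
    rewrite addr0 /G -yE mulrA -exprD; congr (_ * _).
    by rewrite addSn addnS !exprS mulrA mulrNN !mul1r addnC.
  have /negPf-> : (val y' : seq T) != y.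
    by apply: contraNneq y'y => /val_inj y'E; apply/eqP/val_inj.
  by rewrite mulr0 mul0r.
rewrite big1 => [|y' _].
  rewrite /G -yE; case: eqP => [zE|]; last by rewrite mulr0.
  by rewrite (is_gen_omit (valP x) (valP z) yE zE) in ngy.
case: eqP => [y'E|]; last by rewrite mulr0 mul0r.
have y'y : val y' = y by apply: val_inj; rewrite /= yE.
by rewrite -y'y (valP y') in ngy.
Qed.

End MagnitudeComplex.

(** * Coefficients of the magnitude *)

Lemma coefzXn m n : coefz (zpsX ^+ m) n = (n == m)%:R.
Proof.
elim: m n => [//|m IHm] n; rewrite exprS coefzM.
case: n => [|n]; first by rewrite big_ord1 mul0r.
rewrite big_ord_recl mul0r add0r big_ord_recl mul1r subSS subn0 IHm eqSS.
by rewrite big1 ?addr0 // => i _; rewrite mul0r.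
Qed.

Lemma coefz_sign k f n : coefz ((-1) ^+ k * f) n = (-1) ^+ k * coefz f n.
Proof. by rewrite -[in LHS]signr_odd -[in RHS]signr_odd !mulr_sign; case: odd. Qed.

Lemma coefz_natM m f n : coefz (m%:R * f) n = m%:R * coefz f n.
Proof.
rewrite !mulr_natl; elim: m => [//|m IHm].
by rewrite !mulrS coefzD IHm.
Qed.

Lemma coefzM_eq0 f g n :
  (forall m, (m <= n)%N -> coefz g m = 0) -> coefz (f * g) n = 0.
Proof.
by move=> g0; rewrite coefzM big1 // => i _; rewrite g0 ?mulr0 ?leq_subr.
Qed.

Lemma zpsXoM a b : zpsXo (oaddn a b) = zpsXo a * zpsXo b.
Proof. by case: a b => [m|] [n|] /=; rewrite ?mul0r ?mulr0 ?exprD. Qed.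

Lemma coefz_zpsXo a n : coefz (zpsXo a) n = (a == Some n)%:R.
Proof. by case: a => [m|] //=; rewrite coefzXn eq_sym. Qed.

Lemma sum_tuple_cons (T : finType) (V : nmodType) k (F : seq T -> V) :
  \sum_(x : k.+1.-tuple T) F x = \sum_a \sum_(p : k.-tuple T) F (a :: p).
Proof.
rewrite pair_big /= (reindex (fun ap : T * k.-tuple T => [tuple of ap.1 :: ap.2])).
  by [].
exists (fun x => (thead x, [tuple of behead x])) => [[a p]|x] _ /=.
  by congr (_, _); apply: val_inj.
by rewrite -tuple_eta.
Qed.

Lemma sum_enum_val (T : finType) (V : nmodType) (F : T -> V) :
  \sum_a F a = \sum_(i < #|T|) F (enum_val i).
Proof. by rewrite -big_enum_val; apply: eq_bigl. Qed.

Section MagnitudeCoefficients.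
Variables (T : finType) (e : rel T).

(** Distinct vertices are at distance at least 1. *)
Lemma size_le_walk_length a s l :
  path (fun x y => x != y) a s -> walk_length e a s = Some l -> (size s <= l)%N.
Proof.
elim: s a l => [|b s IHs] a l //= /andP[ab bs].
have : gdist e a b != Some 0%N by rewrite gdist_eq0.
case: gdist => [[|m]|] // _; case sE: walk_length => [n|] // [<-].
by rewrite addSn ltnS (leq_trans (IHs _ _ bs sE)) ?leq_addl.
Qed.

(** The weight of a walk a, s_1, ..., s_k is the product along it of the
    entries of the similarity matrix with its diagonal replaced by 0, hence
    q^length if consecutive vertices are distinct, and 0 otherwise. *)
Definition walk_weight (a : T) (s : seq T) : zps :=
  if path (fun x y => x != y) a s then zpsXo (walk_length e a s) else 0.

Lemma walk_weight_cons a b s :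
  walk_weight a (b :: s) =
  (if a == b then 0 else zpsXo (gdist e a b)) * walk_weight b s.
Proof.
rewrite /walk_weight /=; case: eqP => _ /=; first by rewrite mul0r.
by case: ifP => _; rewrite ?mulr0 // zpsXoM.
Qed.

Lemma coefz_walk_weight a s n :
  coefz (walk_weight a s) n =
  (path (fun x y => x != y) a s && (walk_length e a s == Some n))%:R.
Proof. by rewrite /walk_weight; case: path; rewrite ?coefz_zpsXo. Qed.

(** With the similarity matrix written 1 + N, this is N^k applied to the all-ones
    column vector. *)
Definition walk_sums k : 'cV[zps]_#|T| :=
  \col_i \sum_(p : k.-tuple T) walk_weight (enum_val i) p.

Lemma walk_sums0 : walk_sums 0 = const_mx 1.
Proof.
apply/colP => i; rewrite !mxE (big_pred1 [tuple]) // => p.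
by apply/esym/eqP/tuple0.
Qed.

Lemma similarity_walk_sums k :
  similarity e *m walk_sums k = walk_sums k + walk_sums k.+1.
Proof.
apply/colP => i; rewrite !mxE sum_tuple_cons.
rewrite [X in _ = _ + X]sum_enum_val.
under [X in _ = _ + X]eq_bigr => j _.
  under eq_bigr do rewrite walk_weight_cons.
  rewrite -mulr_sumr.
  over.
rewrite (bigD1 i) //= [X in _ = _ + X](bigD1 i) //= eqxx mul0r add0r.
rewrite !mxE; congr (_ + _).
  have /eqP-> : gdist e (enum_val i) (enum_val i) == Some 0%N.
    by rewrite gdist_eq0.
  by rewrite mul1r.
apply: eq_bigr => j ji; rewrite !mxE (inj_eq enum_val_inj) eq_sym.
by rewrite (negPf ji).
Qed.

Lemma card_gen_walk_sums k n :
  coefz (\sum_i walk_sums k i 0) n = #|gen e k n|%:R.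
Proof.
under eq_bigr do rewrite mxE.
rewrite -(sum_enum_val (fun a => \sum_(p : k.-tuple T) walk_weight a p)) /=.
pose F (x : seq T) := if x is a :: p then walk_weight a p else 0.
rewrite -(sum_tuple_cons k F) coefz_sum card_sig -sum1_card natr_sum.
rewrite [RHS]big_mkcond; apply: eq_bigr => x _.
rewrite inE is_genE; case/tupleP: x => a p /=.
by rewrite coefz_walk_weight theadE; case: ifP.
Qed.

Lemma gen_size_le k l : (0 < #|gen e k l|)%N -> (k <= l)%N.
Proof.
case/card_gt0P => x _; have := valP x; rewrite is_genE => /andP[xp /eqP xl].
by have := size_le_walk_length xp xl; rewrite size_behead size_tuple.
Qed.

(** The geometric series for the inverse of 1 + N, applied to the all-ones vector
    and truncated after k = n. The error term is the inverse matrix applied to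
    N^(n+1), whose entries are divisible by q^(n+1) because walks with more than
    n steps have length more than n. *)
Lemma coefz_magnitude n :
  coefz (magnitude e) n = \sum_(k < n.+1) (-1) ^+ k * #|gen e k n|%:R.
Proof.
pose S := \sum_(k < n.+1) (-1) ^+ k *: walk_sums k.
(* The product telescopes, by [similarity_walk_sums]. *)
have ZS : similarity e *m S = const_mx 1 + (-1) ^+ n *: walk_sums n.+1.
  rewrite /S; elim: (n) => [|m IHm].
    by rewrite big_ord1 !expr0 !scale1r similarity_walk_sums walk_sums0.
  rewrite big_ord_recr /= mulmxDr IHm -scalemxAr similarity_walk_sums.
  by rewrite scalerDr exprS mulN1r !scaleNr -addrA addNKr.
have SE : invmx (similarity e) *m const_mx 1 =
    S - (-1) ^+ n *: (invmx (similarity e) *m walk_sums n.+1).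
  rewrite -[X in X - _](mulKmx (similarity_unit e)) ZS mulmxDr -scalemxAr.
  by rewrite addrK.
have -> : magnitude e =
    \sum_i (invmx (similarity e) *m const_mx 1 : 'cV_#|T|) i 0.
  apply: eq_bigr => i _; rewrite mxE; apply: eq_bigr => j _.
  by rewrite mxE mulr1.
rewrite SE.
have tail0 i : coefz ((invmx (similarity e) *m walk_sums n.+1) i 0) n = 0.
  rewrite mxE coefz_sum big1 // => j _; apply: coefzM_eq0 => m le_mn.
  rewrite mxE coefz_sum big1 // => p _; rewrite coefz_walk_weight.
  case: path (@size_le_walk_length (enum_val j) p m) => //= /(_ isT).
  case: eqP => //= -> /(_ erefl); rewrite size_tuple.
  by rewrite leqNgt ltnS le_mn.
under eq_bigr => i _ do rewrite mxE [X in _ + X]mxE [X in - X]mxE /S summxE.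
rewrite coefz_sum.
under eq_bigr => i _ do rewrite coefzB coefz_sign tail0 mulr0 subr0 coefz_sum.
rewrite exchange_big; apply: eq_bigr => k _ /=.
rewrite -card_gen_walk_sums coefz_sum mulr_sumr.
by apply: eq_bigr => i _; rewrite mxE coefz_sign.
Qed.

End MagnitudeCoefficients.

(** * The Euler characteristic of the magnitude complex *)

Lemma alternating_sum_telescope (b h r : nat -> int) n :
  (forall k, b k = h k + r k + r k.+1) -> r 0%N = 0 ->
  \sum_(k < n) (-1) ^+ k * h k =
  \sum_(k < n) (-1) ^+ k * b k + (-1) ^+ n * r n.
Proof.
move=> bE r0; elim: n => [|n IHn]; first by rewrite !big_ord0 r0 mulr0.
rewrite !big_ord_recr /= IHn bE exprS mulN1r !mulrDr mulNr.
by rewrite -!addrA subrr addr0; congr (_ + _); rewrite addrC.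
Qed.

Section EulerCharacteristic.
Variables (T : finType) (e : rel T).

Lemma zrank_MH_boundary k l :
  (zrank (MH e k l) + \rank (ratmx (@boundary T e k l))
     + \rank (ratmx (@boundary T e k.+1 l)) = #|gen e k l|)%N.
Proof. exact: zrank_homologyE (@boundary_boundary T e k l). Qed.

Lemma zrank_MH_gt k l : (l < k)%N -> zrank (MH e k l) = 0%N.
Proof.
move=> lt_lk; have /eqP := zrank_MH_boundary k l.
have gen0 : #|gen e k l| = 0%N.
  apply/eqP; rewrite -leqn0 leqNgt; apply: contraL lt_lk => /gen_size_le.
  by rewrite -leqNgt.
by rewrite [X in _ == X]gen0 !addn_eq0 => /andP[/andP[/eqP]].
Qed.

(** The Euler-Poincare principle: the ranks of the boundary maps cancel in the
    alternating sum. Both ends contribute nothing, the boundary map out of degree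
    0 being zero and there being no generators in degree l + 1. *)
Lemma euler_characteristic l :
  \sum_(k < l.+1) (-1) ^+ k * (zrank (MH e k l))%:R =
  \sum_(k < l.+1) (-1) ^+ k * #|gen e k l|%:R :> int.
Proof.
pose b k : int := #|gen e k l|%:R.
pose h k : int := (zrank (MH e k l))%:R.
pose r k : int := (\rank (ratmx (@boundary T e k l)))%:R.
have bE k : b k = h k + r k + r k.+1 by rewrite -!natrD zrank_MH_boundary.
have r0 : r 0%N = 0.
  suff rk0 : ratmx (@boundary T e 0 l) = 0 by rewrite /r rk0 mxrank0.
  by apply/row_matrixP => i; rewrite rowK row0 raddf0.
have rl : r l.+1 = 0.
  apply/eqP; rewrite pnatr_eq0 -leqn0 (leq_trans (rank_leq_row _)) // leqNgt.
  by apply/negP => /gen_size_le; rewrite ltnn.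
by rewrite (alternating_sum_telescope l.+1 bE r0) rl mulr0 addr0.
Qed.

End EulerCharacteristic.

Theorem theorem8 (T : finType) (e : rel T)
    (e_sym : symmetric e) (e_irr : irreflexive e) :
  zps_has_sum
    (fun kl : nat * nat =>
       (-1) ^+ kl.1 * (zrank (MH e kl.1 kl.2))%:R * zpsX ^+ kl.2)
    (magnitude e).
Proof.
move=> n.
have termE kl : coefz ((-1) ^+ kl.1 * (zrank (MH e kl.1 kl.2))%:R
      * zpsX ^+ kl.2) n =
    (-1) ^+ kl.1 * (zrank (MH e kl.1 kl.2))%:R * (n == kl.2)%:R.
  by rewrite -mulrA coefz_sign coefz_natM coefzXn mulrA.
(* Only the pairs (k, n) with k <= n contribute to the coefficient of q^n. *)
pose support := [seq (k, n) | k <- iota 0 n.+1].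
have out kl : kl \notin support ->
    coefz ((-1) ^+ kl.1 * (zrank (MH e kl.1 kl.2))%:R * zpsX ^+ kl.2) n = 0.
  case: kl => k l kl_out; rewrite termE /=.
  case: eqP => [nl|_]; last by rewrite mulr0.
  rewrite -nl in kl_out *.
  rewrite zrank_MH_gt ?mulr0 ?mul0r // ltnNge; apply: contra kl_out => le_kn.
  by apply/mapP; exists k; rewrite // mem_iota add0n ltnS.
split.
  apply: (sub_finite_set _ (finite_seq support)) => kl nz.
  by apply: contraNT nz => /out /eqP.
rewrite (fsbigE support) //; last by move=> kl _ /out.
  under eq_bigl do rewrite in_setT.
  rewrite big_map -[iota _ _]/(index_iota 0 n.+1) big_mkord.
  rewrite coefz_magnitude -euler_characteristic.
  by apply: eq_bigr => k _; rewrite termE eqxx mulr1.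
by rewrite map_inj_uniq ?iota_uniq // => k k' [].
Qed.
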